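(* Let $n$ be a positive integer and $m\ge2$ an integer. The following are equivalent for maps $\phi_i:\mathbf{RS}_n\to\mathbf{RS}_n$ ($i=1,\ldots,m$): (1) $\operatorname{tr}(\phi_1(A_1)\cdots\phi_m(A_m))=\operatorname{tr}(A_1\cdots A_m)$ for all $A_1,\ldots,A_m\in\mathbf{RS}_n$. (2) $\operatorname{spec}(\phi_1(A_1)\cdots\phi_m(A_m))=\operatorname{spec}(A_1\cdots A_m)$ for all $A_1,\ldots,A_m\in\mathbf{RS}_n$. (3) There exist $n\times n$ permutation matrices $P_1,P_2,\ldots,P_m,P_{m+1}$ with $P_{m+1}=P_1$, and maps $\gamma_i:\mathbf{RS}_n\to R_n$ ($i=1,\ldots,m$), such that for all $A=A_{\mathbf{DS}}+A_R\in\mathbf{RS}_n$, $$\phi_i(A)=P_iA_{\mathbf{DS}}P_{i+1}^t+\gamma_i(A),\qquad i\in\{1,\ldots,m\},$$ in which each $\gamma_i$ makes $\phi_i(A)\in\mathbf{RS}_n$ for all $A\in\mathbf{RS}_n$. Moreover, if $\phi_\ell$ is linear for a certain $\ell\in\{1,\ldots,m\}$, then: (a) when $n=2$, there is a constant $c_\ell\in[-1,1]$ such that $\phi_\ell(A)=P_\ell(A_{\mathbf{DS}}+c_\ell A_R)P_{\ell+1}^t=P_\ell A_{\mathbf{DS}}P_{\ell+1}^t+c_\ell A_RP_{\ell+1}^t$ for all $A\in\mathbf{RS}_2$; (b) when $n\ge3$, $\phi_\ell(A)=P_\ell AP_{\ell+1}^t$ for all $A\in\mathbf{RS}_n$.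
   Context: $\mathbf{DS}_n$ (resp. $\mathbf{RS}_n$) is the set of $n\times n$ doubly stochastic (resp. row stochastic) matrices: real, entrywise nonnegative, with all row sums and column sums (resp. all row sums) equal to $1$. $\langle\cdot\rangle$ denotes the real linear span. Let $e=(1,\ldots,1)^t\in\mathbb{R}^n$ and $R_n=\{ev^t: v\in\mathbb{R}^n,\ v^te=0\}$. One has the vector space direct sum $\langle\mathbf{RS}_n\rangle=\langle\mathbf{DS}_n\rangle\oplus R_n$, and for $A\in\langle\mathbf{RS}_n\rangle$ we write $A=A_{\mathbf{DS}}+A_R$ with $A_{\mathbf{DS}}\in\langle\mathbf{DS}_n\rangle$ and $A_R\in R_n$; explicitly, $A_R=er^t$ where $r_i=\frac1n\sum_{k}a_{ki}-\frac1{n^2}\sum_{k,l}a_{kl}$ and $A_{\mathbf{DS}}=A-A_R$. A function $\phi:S\to T$ between subsets of real vector spaces is called linear if it can be extended to an $\mathbb{R}$-linear map from the span of $S$ to the span of $T$; the maps $\phi_i$ are not assumed linear except where stated. $\operatorname{spec}(A)$ is the spectrum (multiset of complex eigenvalues) counting multiplicities. *)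

(* Defs.v *)
From mathcomp Require Import all_boot all_order all_algebra.
From mathcomp Require Import finmap multiset.
From mathcomp Require Import reals complex ring.

Set Implicit Arguments.
Unset Strict Implicit.
Unset Printing Implicit Defensive.
Import Order.TTheory GRing.Theory Num.Theory.
Local Open Scope ring_scope.
Local Open Scope complex_scope.
Local Open Scope mset_scope.

Section LinearSpan.
Variables (R : pzRingType) (V W : lmodType R).

Definition lspan (S : V -> Prop) (v : V) : Prop :=
  exists (k : nat) (a : 'I_k -> R) (s : 'I_k -> V),
    (forall i, S (s i)) /\ v = \sum_(i < k) a i *: s i.

End LinearSpan.

(* The values of [F] outside [lspan S] are irrelevant: [F] stands for a
   linear map from the span of [S] to the span of [T]. *)
Definition linear_between (R : pzRingType) (V W : lmodType R)
    (S : V -> Prop) (T : W -> Prop) (f : V -> W) : Prop :=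
  exists F : V -> W,
    [/\ forall v, lspan S v -> lspan T (F v),
        forall (a : R) (u v : V), lspan S u -> lspan S v ->
          F (a *: u + v) = a *: F u + F v
      & forall v, S v -> F v = f v].

Section Stochastic.
Variables (R : realType) (n : nat).
Implicit Types A B C : 'M[R]_n.

Definition RS A : Prop :=
  (forall i j, 0 <= A i j) /\ (forall i, \sum_j A i j = 1).

Definition DS A : Prop :=
  [/\ forall i j, 0 <= A i j,
      forall i, \sum_j A i j = 1
    & forall j, \sum_i A i j = 1].

Definition evec : 'cV[R]_n := const_mx 1.

Definition Rn A : Prop :=
  exists2 v : 'cV[R]_n, v^T *m evec = 0 & A = evec *m v^T.

Definition rvec A : 'cV[R]_n :=
  \col_i (n%:R^-1 * (\sum_k A k i) - (n%:R ^+ 2)^-1 * (\sum_k \sum_l A k l)).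

Definition partR A : 'M[R]_n := evec *m (rvec A)^T.

Definition partDS A : 'M[R]_n := A - partR A.

(* The multiset of complex roots of the characteristic polynomial; see [specE]. *)
Definition spec A : {mset R[i]} :=
  seq_mset (sval (closed_field_poly_normal
                    (char_poly (map_mx (real_complex R) A)))).

Lemma specE A (z : R[i]) :
  spec A z = mup z (char_poly (map_mx (real_complex R) A)).
Proof.
rewrite /spec; case: closed_field_poly_normal => r /= ->.
by rewrite (monicP (char_poly_monic _)) scale1r mset_seqE mu_prod_XsubC.
Qed.

Lemma RnP A : Rn A <->
  exists2 v : 'I_n -> R, \sum_i v i = 0 & forall i j, A i j = v j.
Proof.
split=> [[v hv ->]|[v hv hA]].
  exists (fun i => v i 0).
    move/matrixP/(_ 0 0): hv => hv; rewrite !mxE in hv; rewrite -[RHS]hv.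
    by apply: eq_bigr => i _; rewrite !mxE mulr1.
  by move=> i j; rewrite !mxE big_ord1 !mxE mul1r.
exists (\col_i v i).
  apply/matrixP => i j; rewrite !ord1 !mxE -[RHS]hv.
  by apply: eq_bigr => k _; rewrite !mxE mulr1.
by apply/matrixP => i j; rewrite !mxE big_ord1 !mxE mul1r hA.
Qed.

Lemma sum_comb k (a : 'I_k -> R) (s : 'I_k -> 'M[R]_n) (p q : 'I_n -> 'I_n) :
  (forall l, \sum_x s l (p x) (q x) = 1) ->
  \sum_x (\sum_l a l *: s l) (p x) (q x) = \sum_l a l.
Proof.
move=> hs.
under eq_bigr => x _ do rewrite summxE.
rewrite exchange_big /=; apply: eq_bigr => l _.
under eq_bigr => x _ do rewrite mxE.
by rewrite -mulr_sumr hs mulr1.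
Qed.

(* A matrix with constant row sums becomes nonnegative after adding a multiple
   of the all-ones matrix, and is then a multiple of a stochastic matrix. *)
Lemma span_shift (S : 'M[R]_n -> Prop) A (c : R) : (0 < n)%N ->
  S (const_mx n%:R^-1) -> (forall i, \sum_j A i j = c) ->
  (forall t : R, 0 < c + t -> (forall i j, 0 <= A i j + t / n%:R) ->
     S ((c + t)^-1 *: (A + t *: const_mx n%:R^-1))) ->
  lspan S A.
Proof.
move=> n0 hJ hc hS.
pose M := \sum_i \sum_j `|A i j|.
have n0' : 0 < n%:R :> R by rewrite ltr0n.
have M0 : 0 <= M by apply: sumr_ge0 => i _; apply: sumr_ge0.
have hrow i : \sum_j `|A i j| <= M.
  by rewrite /M [leRHS](bigD1 i) //= lerDl; apply: sumr_ge0 => *; apply: sumr_ge0.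
have hent i j : `|A i j| <= M.
  by apply: le_trans (hrow i); rewrite (bigD1 j) //= lerDl; apply: sumr_ge0.
pose t := n%:R * M + 1.
have hct : 0 < c + t.
  have h : - M <= c.
    rewrite -(hc (Ordinal n0)) lerNl -sumrN.
    apply: le_trans (hrow (Ordinal n0)); apply: ler_sum => j _.
    by rewrite -normrN ler_norm.
  rewrite -[ltLHS](subrr M) [ltLHS]addrC; apply: ler_ltD => //.
  by rewrite ltr_pwDr // ler_peMl // ler1n.
have hSt := hS t hct _.
exists 2, (fun i => if i == 0 :> 'I_2 then c + t else - t),
  (fun i => if i == 0 :> 'I_2 then
     (c + t)^-1 *: (A + t *: const_mx n%:R^-1) else const_mx n%:R^-1).
split=> [i|].
  case: ifP => // _; apply: hSt => i0 j0.
  have hA : - A i0 j0 <= M.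
    by apply: le_trans (hent i0 j0); rewrite -normrN ler_norm.
  have ninv : 0 <= n%:R^-1 :> R by rewrite invr_ge0 ltW.
  rewrite /t mulrDl mulrAC divff ?gt_eqF // !mul1r addrA addr_ge0 //.
  by rewrite -(subrr (A i0 j0)) lerD2l.
rewrite big_ord_recl big_ord1 /= scalerA divff ?gt_eqF // scale1r.
by rewrite scaleNr addrK.
Qed.

Lemma lspan_RSP A : (0 < n)%N ->
  lspan RS A <-> exists c, forall i, \sum_j A i j = c.
Proof.
move=> n0; have n0' : n%:R != 0 :> R by rewrite pnatr_eq0 -lt0n.
split=> [[k [a [s [hs ->]]]]|[c hc]].
  exists (\sum_l a l) => i.
  by apply: (sum_comb a (p := fun=> i) (q := id)) => l; case: (hs l).
have sumJ : \sum_(i < n) n%:R^-1 = 1 :> R.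
  by rewrite sumr_const card_ord -[RHS](mulVf n0') mulr_natr.
apply: (@span_shift _ A c) => // [|t ct ge0].
  split=> [i j|i]; first by rewrite mxE invr_ge0 ler0n.
  by under eq_bigr => j _ do rewrite mxE.
split=> [i j|i]; first by rewrite !mxE mulr_ge0 // invr_ge0 ltW.
under eq_bigr => j _ do rewrite !mxE.
by rewrite -mulr_sumr big_split /= hc -mulr_sumr sumJ mulr1 mulVf // gt_eqF.
Qed.

Lemma lspan_DSP A : (0 < n)%N ->
  lspan DS A <->
  exists c, (forall i, \sum_j A i j = c) /\ (forall j, \sum_i A i j = c).
Proof.
move=> n0; have n0' : n%:R != 0 :> R by rewrite pnatr_eq0 -lt0n.
split=> [[k [a [s [hs ->]]]]|[c [hc hc']]].
  exists (\sum_l a l); split=> i.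
    by apply: (sum_comb a (p := fun=> i) (q := id)) => l; case: (hs l).
  by apply: (sum_comb a (p := id) (q := fun=> i)) => l; case: (hs l).
have sumJ : \sum_(i < n) n%:R^-1 = 1 :> R.
  by rewrite sumr_const card_ord -[RHS](mulVf n0') mulr_natr.
apply: (@span_shift _ A c) => // [|t ct ge0].
  split=> [i j|i|i]; first by rewrite mxE invr_ge0 ler0n.
    by under eq_bigr => j _ do rewrite mxE.
  by under eq_bigr => j _ do rewrite mxE.
split=> [i j|i|i]; first by rewrite !mxE mulr_ge0 // invr_ge0 ltW.
  under eq_bigr => j _ do rewrite !mxE.
  by rewrite -mulr_sumr big_split /= hc -mulr_sumr sumJ mulr1 mulVf // gt_eqF.
under eq_bigr => j _ do rewrite !mxE.
by rewrite -mulr_sumr big_split /= hc' -mulr_sumr sumJ mulr1 mulVf // gt_eqF.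
Qed.

Lemma partRE A i j : partR A i j = rvec A j 0.
Proof. by rewrite !mxE big_ord1 !mxE mul1r. Qed.

Lemma sum_cst (x : R) : \sum_(i < n) x = x * n%:R.
Proof. by rewrite sumr_const card_ord mulr_natr. Qed.

Lemma sum_rvec A : (0 < n)%N -> \sum_j rvec A j 0 = 0.
Proof.
move=> n0; have n0' : n%:R != 0 :> R by rewrite pnatr_eq0 -lt0n.
under eq_bigr => j _ do rewrite mxE.
by rewrite sumrB -mulr_sumr exchange_big /= sum_cst; field.
Qed.

Lemma partR_Rn A : (0 < n)%N -> Rn (partR A).
Proof.
move=> n0; apply/RnP; exists (fun j => rvec A j 0); first exact: sum_rvec.
exact: partRE.
Qed.

(* [partDS A + partR A] is the decomposition of [A] along the direct sum of
   [lspan DS] and [Rn]. *)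
Lemma decompP A : (0 < n)%N -> lspan RS A ->
  [/\ lspan DS (partDS A), Rn (partR A) & A = partDS A + partR A].
Proof.
move=> n0 /(lspan_RSP _ n0)[c hc].
have n0' : n%:R != 0 :> R by rewrite pnatr_eq0 -lt0n.
split; [|exact: partR_Rn|by rewrite subrK].
apply/lspan_DSP => //; exists c; split=> i.
  under eq_bigr => j _ do rewrite mxE [X in _ + X]mxE partRE.
  by rewrite sumrB hc sum_rvec // subr0.
under eq_bigr => j _ do rewrite mxE [X in _ + X]mxE partRE.
rewrite sumrB sum_cst mxE.
under [X in _ - (_ - _ * X) * _]eq_bigr => k _ do rewrite hc.
by rewrite sum_cst; field.
Qed.

Lemma decomp_uniq B C : (0 < n)%N -> lspan DS B -> Rn C ->
  [/\ lspan RS (B + C), partDS (B + C) = B & partR (B + C) = C].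
Proof.
move=> n0 /(lspan_DSP _ n0)[c [hr hc]] /RnP[v hv hC].
have n0' : n%:R != 0 :> R by rewrite pnatr_eq0 -lt0n.
have hrow i : \sum_j (B + C) i j = c.
  under eq_bigr => j _ do rewrite mxE hC.
  by rewrite big_split /= hr hv addr0.
have hR : partR (B + C) = C.
  apply/matrixP => i j; rewrite partRE hC mxE.
  under [X in _ - _ * X]eq_bigr => k _ do rewrite hrow.
  under [X in _ * X - _]eq_bigr => k _ do rewrite mxE hC.
  by rewrite big_split /= hc !sum_cst; field.
by split=> //; [apply/lspan_RSP => //; exists c | rewrite /partDS hR addrK].
Qed.

End Stochastic.

(* The matrices [P_1, ..., P_(m+1)] are encoded as [P : 'I_m.+1 -> 'M_n], shifted
   to start at index 0; [Pcur P i] and [Pnext P i] are [P_i] and [P_(i+1)]. *)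
Definition Pcur (R : realType) (n m : nat) (P : 'I_m.+1 -> 'M[R]_n) (i : 'I_m) :=
  P (widen_ord (leqnSn m) i).
Definition Pnext (R : realType) (n m : nat) (P : 'I_m.+1 -> 'M[R]_n) (i : 'I_m) :=
  P (lift ord0 i).

Definition has_form (R : realType) (n m : nat)
    (phi : 'I_m -> 'M[R]_n -> 'M[R]_n)
    (P : 'I_m.+1 -> 'M[R]_n) (gamma : 'I_m -> 'M[R]_n -> 'M[R]_n) : Prop :=
  [/\ forall i, is_perm_mx (P i),
      P ord_max = P ord0,
      forall i A, RS A -> Rn (gamma i A),
      forall i A, RS A ->
        phi i A = Pcur P i *m partDS A *m (Pnext P i)^T + gamma i A
    & forall i A, RS A -> RS (Pcur P i *m partDS A *m (Pnext P i)^T + gamma i A)].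

(* Main.v *)
Require Import Defs.
From mathcomp Require Import all_boot all_order all_algebra.
From mathcomp Require Import fingroup perm.
From mathcomp Require Import finmap multiset.
From mathcomp Require Import reals complex.
From mathcomp Require Import ring lra zify.

Import Order.TTheory GRing.Theory Num.Theory.
Local Open Scope ring_scope.

Set Implicit Arguments.
Unset Strict Implicit.
Unset Printing Implicit Defensive.

(** Everything happens modulo the space [Rn] of matrices [e v^T] with
[v^T e = 0].  Among matrices with constant row sums [Rn] is a two-sided ideal
whose elements have trace zero, and adding such an element does not even change
the characteristic polynomial ([char_poly_Rn]): in a basis starting with [e]
only the off-diagonal block moves.  Since [A] and [A_DS] agree modulo [Rn],
[cond3] says that [phi_i(A)] is congruent to [P_i A P_(i+1)^T], and then
[cond3 -> cond2] is a telescoping product followed by a permutation similarity, while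
[cond2 -> cond1] reads the trace off the characteristic polynomial.

[cond1 -> cond3] rests on two facts about row stochastic matrices: trace [n] forces
the identity, and a row stochastic matrix with a row stochastic inverse is a
permutation matrix.  Hence the matrices [phi_i(1)] are permutation matrices, of
product 1, and multiplying by their partial products one may assume
[phi_i(1) = 1].  Feeding identity matrices into all slots but two leaves pairs
of maps [chi], [eta] with [tr (chi A * eta B) = tr (A B)].  Both permute the
permutation matrices, and tests [X |-> tr (X * perm)] detect membership in [Rn];
so [chi] respects linear relations modulo [Rn], although it is not assumed
linear.

The pair is then rigid ([chi_conj]).  Let [T i j] ([redirect i j]) be the matrix of the
self-map of indices that sends [i] to [j] and fixes everything else.  The
relation [T i j + T j i = 1 + (i j)], together with the fact that [chi] sends
the transposition [(i j)] to a transposition [(p q)], confines the off-diagonal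
part of [chi (T i j)] to the positions [(p, q)] and [(q, p)].  The relation
[sum_i T i j = (n - 1) 1 + e e_j^T] gives the total weight [u_l] of column [l]
in the images; as distinct transpositions have distinct images,
[u_k + u_l] is 0 or 1 for [k <> l], and [sum u = 1] with [n >= 3] makes [u] the
indicator of one index [c j].  Comparing [T i j] with [T j i] yields
[chi (T i j) = T (c i) (c j)].  The [T i j] being again a separating family,
[chi] is conjugation by the permutation [c] modulo [Rn].  For [n <= 2] a
permutation is determined by its trace and [chi A] is congruent to [A].

For the linear case, a nonnegative matrix congruent to [A] modulo [Rn] equals
[A] as soon as every column of [A] has a zero entry ([Rn_ge_eq]).  When
[n >= 3] this applies to all the [T i j], which span; when [n = 2] it applies to
the two permutation matrices, and the image of the single remaining generator
determines the constant [c_l]. *)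

(** * Row stochastic and permutation matrices *)

Section Basics.
Variables (R : realType) (n : nat).
Implicit Types (A B X Y N : 'M[R]_n) (f : 'I_n -> 'I_n) (s t : 'S_n).

Local Notation e := (evec R n).

Definition fun_mx f : 'M[R]_n := \matrix_(i, j) (f i == j)%:R.

Lemma row_sumsP X c : (forall i, \sum_j X i j = c) <-> X *m e = c *: e.
Proof.
split=> [h|/matrixP h i].
  apply/matrixP=> i j; rewrite !mxE mulr1 -(h i).
  by apply: eq_bigr => k _; rewrite mxE mulr1.
have := h i 0; rewrite !mxE mulr1 => <-.
by apply: eq_bigr => k _; rewrite mxE mulr1.
Qed.

Lemma RS_evec A : RS A -> A *m e = e.
Proof. by case=> _ /row_sumsP ->; rewrite scale1r. Qed.

Lemma RS_mul A B : RS A -> RS B -> RS (A *m B).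
Proof.
move=> hA hB; split.
  move=> i j; rewrite mxE; apply: sumr_ge0 => k _.
  by apply: mulr_ge0; [apply hA.1|apply hB.1].
by apply/row_sumsP; rewrite -mulmxA (RS_evec hB) (RS_evec hA) scale1r.
Qed.

Lemma fun_mx_RS f : RS (fun_mx f).
Proof.
split=> [i j|i]; first by rewrite mxE ler0n.
rewrite (bigD1 (f i)) //= mxE eqxx big1 ?addr0 // => j hj.
by rewrite mxE eq_sym (negPf hj).
Qed.

Lemma perm_mx_fun s : perm_mx s = fun_mx s.
Proof. by apply/matrixP=> i j; rewrite !mxE. Qed.

Lemma perm_mx_RS s : RS (perm_mx s : 'M[R]_n).
Proof. by rewrite perm_mx_fun; apply: fun_mx_RS. Qed.

Lemma RS1 : RS (1%:M : 'M[R]_n).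
Proof. by rewrite -perm_mx1; apply: perm_mx_RS. Qed.

Lemma RS_le1 A i j : RS A -> A i j <= 1.
Proof.
by case=> h0 h1; rewrite -(h1 i) (bigD1 j) //= lerDl; apply: sumr_ge0.
Qed.

Lemma RS_eq1_row A i j k : RS A -> A i j = 1 -> k != j -> A i k = 0.
Proof.
case=> h0 h1 hj hk; apply/le_anti; rewrite h0 andbT.
have := h1 i; rewrite (bigD1 j) //= hj (bigD1 k) //=.
have : 0 <= \sum_(l < n | (l != j) && (l != k)) A i l by apply: sumr_ge0.
lra.
Qed.

Lemma RS_off_diag_eq A B : RS A -> RS B ->
  (forall i j, i != j -> A i j = B i j) -> A = B.
Proof.
move=> [_ hA] [_ hB] h; apply/matrixP=> i j.
have [->|/h//] := eqVneq i j.
have := hA j; rewrite -(hB j) (bigD1 j) //= [RHS](bigD1 j) //=.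
rewrite (eq_bigr (B j)); first by move/addIr.
by move=> k hk; rewrite h // eq_sym.
Qed.

(** Diagonal entries are at most 1, so all of them are 1 when they add up to [n]. *)
Lemma RS_tr_eq1 A : RS A -> \tr A = n%:R -> A = 1%:M.
Proof.
move=> hA htr.
have hd i : A i i = 1.
  have := psumr_eq0P (P := xpredT) (F := fun i => 1 - A i i) _ _ => h.
  apply/esym/eqP; rewrite -subr_eq0; apply/eqP; apply: h => //.
    by move=> k _; rewrite subr_ge0 RS_le1.
  by rewrite sumrB -/(mxtrace A) htr sumr_const card_ord subrr.
apply: RS_off_diag_eq => //; first exact: RS1.
move=> i j hij; rewrite mxE (negPf hij) (RS_eq1_row hA (hd i)) //.
by rewrite eq_sym.
Qed.

(** If [A i j > 0], the vanishing of the off-diagonal entries of row [i] of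
[A B = 1] makes row [j] of [B] equal to [e_i]; then row [j] of [B A = 1] says
that row [i] of [A] is [e_j]. *)
Lemma RS_inv_perm A B : RS A -> RS B -> A *m B = 1%:M -> is_perm_mx A.
Proof.
move=> hA hB hAB; have hBA := mulmx1C hAB.
have ex i : exists j, A i j != 0.
  case: (pickP (fun j => A i j != 0)) => [j|h]; first by exists j.
  have := hA.2 i; rewrite big1 => [|j _]; last by apply/eqP/negbFE/h.
  by move/eqP; rewrite eq_sym oner_eq0.
have key i j : A i j != 0 -> B j i = 1.
  move=> hij; have z k : k != i -> B j k = 0.
    move=> hk; move/matrixP/(_ i k): hAB; rewrite !mxE eq_sym (negPf hk) => h.
    have := psumr_eq0P _ h (i := j) isT => /(_ _)/eqP.
    rewrite mulf_eq0 (negPf hij) /= => h'; apply/eqP/h' => l _.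
    by apply: mulr_ge0; [apply hA.1|apply hB.1].
  by rewrite -(hB.2 j) (bigD1 i) //= big1 ?addr0.
have [f hf] := fin_all_exists ex.
have row i j : A i j = (f i == j)%:R.
  move/matrixP/(_ (f i) j): hBA; rewrite !mxE => <-.
  rewrite (bigD1 i) //= key // mul1r big1 ?addr0 // => k hk.
  by rewrite (RS_eq1_row hB (key _ _ (hf i))) ?mul0r.
have finj : injective f.
  move=> i i' hi; apply/eqP/negP=> /negP hne.
  have := RS_eq1_row hB (key _ _ (hf i)) (k := i'); rewrite eq_sym hne.
  rewrite hi key // => /(_ isT)/eqP.
  by rewrite oner_eq0.
apply/is_perm_mxP; exists (perm finj); rewrite perm_mx_fun.
by apply/matrixP=> i j; rewrite row mxE permE.
Qed.

Lemma mul_perm_mxV s : perm_mx s *m perm_mx s^-1%g = 1%:M :> 'M[R]_n.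
Proof. by rewrite -perm_mxM mulgV perm_mx1. Qed.

Lemma mul_perm_mxVl s : perm_mx s^-1%g *m perm_mx s = 1%:M :> 'M[R]_n.
Proof. by rewrite -perm_mxM mulVg perm_mx1. Qed.

Lemma perm_mx_tr1 s : perm_mx s *m (perm_mx s)^T = 1%:M :> 'M[R]_n.
Proof. by rewrite tr_perm_mx mul_perm_mxV. Qed.

Lemma tr_perm_mx1 s : (perm_mx s)^T *m perm_mx s = 1%:M :> 'M[R]_n.
Proof. by rewrite tr_perm_mx mul_perm_mxVl. Qed.

Lemma perm_mx_inj : injective (@perm_mx R n).
Proof.
move=> s t /matrixP h; apply/permP=> i; have := h i (s i).
rewrite !perm_mx_fun !mxE eqxx; case: eqP => // _ /eqP.
by rewrite oner_eq0.
Qed.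

Lemma mxtrace_fun_mx f X : \tr (fun_mx f *m X) = \sum_k X (f k) k.
Proof.
apply: eq_bigr => k _; rewrite mxE (bigD1 (f k)) //= mxE eqxx mul1r.
rewrite big1 ?addr0 // => j hj; by rewrite mxE eq_sym (negPf hj) mul0r.
Qed.

(** * The ideal [Rn] of matrices with equal rows of sum zero *)

Lemma Rn0 : Rn (0 : 'M[R]_n).
Proof. by apply/RnP; exists (fun=> 0) => [|i j]; rewrite ?mxE // big1. Qed.

Lemma RnD X Y : Rn X -> Rn Y -> Rn (X + Y).
Proof.
move=> /RnP[v hv hX] /RnP[w hw hY]; apply/RnP; exists (fun i => v i + w i).
  by rewrite big_split /= hv hw addr0.
by move=> i j; rewrite mxE hX hY.
Qed.

Lemma RnZ c X : Rn X -> Rn (c *: X).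
Proof.
move=> /RnP[v hv hX]; apply/RnP; exists (fun i => c * v i).
  by rewrite -mulr_sumr hv mulr0.
by move=> i j; rewrite mxE hX.
Qed.

Lemma RnN X : Rn X -> Rn (- X).
Proof. by rewrite -scaleN1r; apply: RnZ. Qed.

Lemma Rn_mull A N c : A *m e = c *: e -> Rn N -> A *m N = c *: N.
Proof. by move=> hA [v hv ->]; rewrite mulmxA hA scalemxAl. Qed.

Lemma Rn_mulr A N c : A *m e = c *: e -> Rn N -> Rn (N *m A).
Proof.
move=> hA [v hv ->]; exists (A^T *m v); rewrite trmx_mul trmxK ?mulmxA //.
by rewrite -mulmxA hA -scalemxAr hv scaler0.
Qed.

Lemma RS_Rn_mull A N : RS A -> Rn N -> A *m N = N.
Proof. by move=> /RS_evec hA hN; rewrite (Rn_mull (c := 1)) ?scale1r. Qed.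

Lemma RS_Rn_mulr A N : RS A -> Rn N -> Rn (N *m A).
Proof. by move=> /RS_evec hA; apply: (Rn_mulr (c := 1)); rewrite scale1r. Qed.

Lemma Rn_tr N : Rn N -> \tr N = 0.
Proof. by move=> /RnP[v <- h]; apply: eq_bigr => i _; rewrite h. Qed.

Lemma Rn_tr_mulr A N : RS A -> Rn N -> \tr (N *m A) = 0.
Proof. by move=> hA hN; apply/Rn_tr/RS_Rn_mulr. Qed.

Lemma Rn_tr_mull A N : RS A -> Rn N -> \tr (A *m N) = 0.
Proof. by move=> hA hN; rewrite mxtrace_mulC Rn_tr_mulr. Qed.

(** The common row of [X - Y] has sum zero, so it vanishes once all its entries
are nonnegative; one row per column is enough to see that. *)
Lemma Rn_ge_eq X Y : Rn (X - Y) -> (forall j, exists i, Y i j <= X i j) ->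
  X = Y.
Proof.
move=> /RnP[v hv h] hex.
have v0 j : 0 <= v j by have [i hi] := hex j; rewrite -(h i) !mxE subr_ge0.
apply/eqP; rewrite -subr_eq0; apply/eqP/matrixP=> i j.
by rewrite h mxE (psumr_eq0P _ hv).
Qed.

Lemma Rn_of_rows_const X : X *m e = 0 -> (forall i i' j, X i j = X i' j) ->
  Rn X.
Proof.
rewrite -(scale0r e) => /row_sumsP hX h.
have [n0|n0] := posnP n.
  apply/RnP; exists (fun=> 0) => [|i]; first by rewrite big1.
  by have := ltn_ord i; rewrite {2}n0.
by pose i0 := Ordinal n0; apply/RnP; exists (X i0).
Qed.

(** * Families that separate matrices modulo [Rn] *)

Definition redirect i j : 'M[R]_n := fun_mx (fun k => if k == i then j else k).

Lemma redirect_RS i j : RS (redirect i j).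
Proof. exact: fun_mx_RS. Qed.

Lemma redirectE i j k l : redirect i j k l = ((if k == i then j else k) == l)%:R.
Proof. by rewrite mxE. Qed.

Lemma redirect_id i : redirect i i = 1%:M.
Proof. by apply/matrixP=> k l; rewrite redirectE mxE; have [->|] := eqVneq k i. Qed.

Lemma mxtrace_redirect i j X : \tr (redirect i j *m X) = \tr X - X i i + X j i.
Proof.
rewrite mxtrace_fun_mx (bigD1 i) //= eqxx /mxtrace (bigD1 i (P := xpredT)) //=.
rewrite (eq_bigr (fun k => X k k)) => [|k /negPf->//].
by rewrite [X i i + _]addrC addrK addrC.
Qed.

(** Testing against [redirect j i] and against the identity [redirect j j] gives
[X i j = X j j]. *)
Lemma redirect_separating X : X *m e = 0 ->
  (forall i j, \tr (redirect i j *m X) = 0) -> Rn X.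
Proof.
move=> hX h; apply: Rn_of_rows_const => //.
have H i j : X i j = X j j.
  have := h j i; have := h j j; rewrite !mxtrace_redirect.
  by rewrite subrK => ->; rewrite add0r addrC => /eqP; rewrite subr_eq0 => /eqP.
by move=> i i' j; rewrite H [RHS]H.
Qed.

(** Two permutations that differ by a transposition give
[X i j + X i' j' = X i j' + X i' j]: differences of rows are constant, and they
are zero because the row sums vanish. *)
Lemma perm_separating X : X *m e = 0 ->
  (forall s, \tr (X *m perm_mx s) = 0) -> Rn X.
Proof.
move=> hX h.
have tr s : \sum_k X (s k) k = 0.
  by rewrite -mxtrace_fun_mx -perm_mx_fun mxtrace_mulC.
have quad i i' j j' : i != i' -> X i j + X i' j' = X i j' + X i' j.
  move=> hi; have [->//|hj] := eqVneq j j'.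
  have [s sj sj'] : exists2 s : 'S_n, s j = i & s j' = i'.
    exists (tperm j i * tperm (tperm j i j') i')%g; rewrite permM ?tpermL //.
    apply: tpermD; last by rewrite eq_sym.
    by rewrite -{2}(tpermL j i) (inj_eq perm_inj) eq_sym.
  have tr2 (u : 'S_n) : X (u j) j + (X (u j') j' +
      \sum_(k | (k != j) && (k != j')) X (u k) k) = 0.
    have hj' : j' != j by rewrite eq_sym.
    by rewrite -[RHS](tr u) [RHS](bigD1 j) //= [X in _ = _ + X](bigD1 j' hj') /=.
  have := tr2 (tperm j j' * s)%g; have := tr2 s.
  rewrite !permM tpermL tpermR sj sj'.
  rewrite (eq_bigr (fun k => X ((tperm j j' * s)%g k) k)); first by lra.
  by move=> k /andP[k1 k2]; rewrite permM tpermD // eq_sym.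
have [n1|n1] := leqP n 1.
  apply: Rn_of_rows_const => // i i' j.
  by congr (X _ _); apply: ord_inj; move: (ltn_ord i) (ltn_ord i') => ? ?; lia.
apply: Rn_of_rows_const => // i i' j.
have [->//|hi] := eqVneq i i'.
move: hX; rewrite -(scale0r e) => /row_sumsP hX.
have : \sum_(k < n) (X i j - X i' j) = \sum_k (X i k - X i' k).
  by apply: eq_bigr => k _; have := quad i i' j k hi; lra.
rewrite sumr_const card_ord sumrB !hX subrr => /eqP.
rewrite mulrn_eq0 => /orP[/eqP n0|]; first by rewrite n0 in n1.
by rewrite subr_eq0 => /eqP.
Qed.

(** * Identities for redirections and transpositions *)

Lemma redirect_pair i j : i != j ->
  redirect i j + redirect j i = 1%:M + perm_mx (tperm i j).
Proof.
move=> hij; apply/matrixP=> k l; rewrite perm_mx_fun !mxE.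
case: tpermP => [->|->|/eqP/negPf-> /eqP/negPf->//].
  by rewrite eqxx (negPf hij) addrC.
by rewrite eqxx [j == i]eq_sym (negPf hij).
Qed.

Lemma perm_conj_mxE s A i j :
  (perm_mx s *m A *m (perm_mx s)^T) i j = A (s i) (s j).
Proof. by rewrite tr_perm_mx -col_permE -row_permE !mxE. Qed.

Lemma RS_perm_conj s A : RS A -> RS (perm_mx s *m A *m (perm_mx s)^T).
Proof.
move=> hA; rewrite tr_perm_mx.
by apply: RS_mul; [apply: RS_mul => //|]; apply: perm_mx_RS.
Qed.

Lemma perm_mx_tr_mul1 s t :
  \tr (perm_mx s *m perm_mx t : 'M[R]_n) = n%:R -> (s * t = 1)%g.
Proof.
rewrite -perm_mxM => /RS_tr_eq1 h; apply: perm_mx_inj.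
by rewrite perm_mx1 h //; apply: perm_mx_RS.
Qed.

Lemma mxtrace_perm_mx s :
  \tr (perm_mx s : 'M[R]_n) = n%:R - #|[set k | s k != k]|%:R.
Proof.
apply/eqP; rewrite eq_sym subr_eq; apply/eqP.
have -> : n%:R = \sum_(k < n) 1 :> R by rewrite sumr_const card_ord.
rewrite -sum1_card natr_sum.
rewrite [X in _ + X]big_mkcond -big_split /=; apply: eq_bigr => k _.
by rewrite inE perm_mx_fun mxE; case: eqP; rewrite /= ?addr0 ?add0r.
Qed.

Lemma RS_trE A : RS A -> \sum_i \sum_(j | j != i) A i j = n%:R - \tr A.
Proof.
move=> [_ hA]; apply/eqP; rewrite eq_sym subr_eq; apply/eqP.
have -> : n%:R = \sum_(k < n) 1 :> R by rewrite sumr_const card_ord.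
rewrite /mxtrace -big_split /=.
by apply: eq_bigr => i _; rewrite -(hA i) (bigD1 i) //= addrC.
Qed.

Lemma mxtrace_redirect1 i j : i != j -> \tr (redirect i j) = n%:R - 1.
Proof.
move=> hij; rewrite -[redirect i j]mulmx1 mxtrace_redirect mxtrace1 !mxE eqxx.
by rewrite eq_sym (negPf hij) addr0.
Qed.

Lemma tperm_edge (p q k l : 'I_n) : k != l -> tperm p q k = l ->
  tperm p q = tperm k l.
Proof.
move=> hkl; case: tpermP => [->->//|->->|_ _ h]; first exact: tpermC.
by rewrite h eqxx in hkl.
Qed.

Lemma is_perm_mx_RS A : is_perm_mx A -> RS A.
Proof. by case/is_perm_mxP=> s ->; apply: perm_mx_RS. Qed.

Lemma is_perm_mx_mulT A : is_perm_mx A -> A *m A^T = 1%:M.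
Proof. by case/is_perm_mxP=> s ->; apply: perm_mx_tr1. Qed.

Lemma is_perm_mx_Tmul A : is_perm_mx A -> A^T *m A = 1%:M.
Proof. by case/is_perm_mxP=> s ->; apply: tr_perm_mx1. Qed.

End Basics.

(** * A pair of maps that preserves the trace pairing *)

Section TracePair.
Variables (R : realType) (n : nat).
Implicit Types (A B X Y N : 'M[R]_n) (s t : 'S_n).
Variables chi eta : 'M[R]_n -> 'M[R]_n.
Hypothesis chiRS : forall A, RS A -> RS (chi A).
Hypothesis etaRS : forall A, RS A -> RS (eta A).
Hypothesis tr_chi_eta : forall A B, RS A -> RS B ->
  \tr (chi A *m eta B) = \tr (A *m B).

Local Notation e := (evec R n).
Local Notation redirect := (@redirect R n).

(** The product is row stochastic of trace [n]; with [RS_inv_perm] this makes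
[chi] and [eta] map permutation matrices to permutation matrices. *)
Lemma chi_eta_perm s t : (s * t = 1)%g ->
  chi (perm_mx s) *m eta (perm_mx t) = 1%:M.
Proof.
move=> st; apply: RS_tr_eq1.
  by apply: RS_mul; [apply: chiRS|apply: etaRS]; apply: perm_mx_RS.
rewrite tr_chi_eta -?perm_mxM ?st ?perm_mx1 ?mxtrace1 //; exact: perm_mx_RS.
Qed.

Lemma chi_perm s : exists s', chi (perm_mx s) = perm_mx s'.
Proof.
apply/is_perm_mxP; have := chi_eta_perm (mulgV s).
by apply: RS_inv_perm; [apply/chiRS|apply/etaRS]; apply: perm_mx_RS.
Qed.

Lemma eta_perm s : exists s', eta (perm_mx s) = perm_mx s'.
Proof.
apply/is_perm_mxP; have := mulmx1C (chi_eta_perm (mulVg s)).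
by apply: RS_inv_perm; [apply/etaRS|apply/chiRS]; apply: perm_mx_RS.
Qed.

Lemma chi_perm_inj s t : chi (perm_mx s) = chi (perm_mx t) -> s = t.
Proof.
move=> h; apply: (mulIg t^-1%g); rewrite mulgV; apply: (@perm_mx_tr_mul1 R).
rewrite -tr_chi_eta; try exact: perm_mx_RS.
by rewrite h chi_eta_perm ?mulgV ?mxtrace1.
Qed.

Lemma eta_perm_inj s t : eta (perm_mx s) = eta (perm_mx t) -> s = t.
Proof.
move=> h; apply: (mulgI t^-1%g); rewrite mulVg; apply: (@perm_mx_tr_mul1 R).
rewrite -tr_chi_eta; try exact: perm_mx_RS.
by rewrite h chi_eta_perm ?mulVg ?mxtrace1.
Qed.

(** An injective self-map of the finite set of permutations is onto. *)
Lemma eta_perm_onto s : exists t, eta (perm_mx t) = perm_mx s.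
Proof.
have [f hf] := fin_all_exists eta_perm.
have finj : injective f by move=> u v h; apply: eta_perm_inj; rewrite !hf h.
by exists (invF finj s); rewrite hf f_invF.
Qed.

(** This is how linear relations modulo [Rn] are transported: pairing a
combination of values of [chi] with [eta (perm_mx s)] gives the trace of the
same combination of the arguments times [perm_mx s]. *)
Lemma eta_separating X : X *m e = 0 ->
  (forall s, \tr (X *m eta (perm_mx s)) = 0) -> Rn X.
Proof.
move=> hX h; apply: perm_separating => // s.
by have [t <-] := eta_perm_onto s.
Qed.

Hypothesis chi1 : chi 1%:M = 1%:M.

Lemma eta1 : eta 1%:M = 1%:M.
Proof.
by have := chi_eta_perm (mulg1 1%g); rewrite perm_mx1 chi1 mul1mx.
Qed.

Lemma mxtrace_chi A : RS A -> \tr (chi A) = \tr A.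
Proof.
by move=> hA; rewrite -[chi A]mulmx1 -eta1 tr_chi_eta ?mulmx1 //; apply: RS1.
Qed.

Lemma mxtrace_eta A : RS A -> \tr (eta A) = \tr A.
Proof.
by move=> hA; rewrite -[eta A]mul1mx -chi1 tr_chi_eta ?mul1mx //; apply: RS1.
Qed.

(** [eta] preserves traces, and for [n <= 2] the trace of a permutation matrix
determines it, so [eta] fixes the permutation matrices. *)
Lemma chi_small : (n <= 2)%N -> forall A, RS A -> Rn (chi A - A).
Proof.
move=> n2 A hA; apply: eta_separating => [|s].
  by rewrite mulmxBl !RS_evec ?subrr //; apply: chiRS.
have heta : eta (perm_mx s) = perm_mx s.
  have [s' hs] := eta_perm s; rewrite hs; congr perm_mx.
  have tr1 u v : \tr (perm_mx u : 'M[R]_n) = \tr (perm_mx v : 'M[R]_n) ->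
      u = 1%g -> v = 1%g.
    move=> + u1; rewrite u1 perm_mx1 mxtrace1 => /esym/RS_tr_eq1.
    by move=> /(_ (perm_mx_RS _ _)); rewrite -perm_mx1 => /perm_mx_inj.
  have htr : \tr (perm_mx s' : 'M[R]_n) = \tr (perm_mx s : 'M[R]_n).
    by rewrite -hs mxtrace_eta //; apply: perm_mx_RS.
  have [s1|s1] := eqVneq s 1%g; first by rewrite s1 (tr1 _ _ (esym htr) s1).
  have [s'1|s'1] := eqVneq s' 1%g; first by rewrite (tr1 _ _ htr s'1) s'1.
  apply/eqP/negP => /negP hne.
  have : (#|[set 1%g; s; s']| <= #|{: 'S_n}|)%N by apply: max_card.
  rewrite card_Sn -setUA !cardsU1 cards1 !inE negb_or !(eq_sym 1%g) s1 s'1.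
  by rewrite (eq_sym s) hne; case: (n) n2 => [|[|[|]]].
by rewrite mulmxBl raddfB /= tr_chi_eta ?heta ?subrr //; apply: perm_mx_RS.
Qed.

Section AtLeastThree.
Hypothesis n_gt2 : (2 < n)%N.

Lemma third (i j : 'I_n) : exists2 k, k != i & k != j.
Proof.
have : (0 < #|~: [set i; j]|)%N.
  have := cardsC [set i; j]; rewrite card_ord cards2; case: (i != j); lia.
by case/card_gt0P=> k; rewrite !inE negb_or => /andP[]; exists k.
Qed.

(** The identity [redirect_pair] gives this equality modulo [Rn].  It is exact
because every column of the right-hand side, a sum of two permutation matrices,
has a zero entry when [n >= 3]. *)
Lemma chi_redirect_pair i j : i != j ->
  chi (redirect i j) + chi (redirect j i) = 1%:M + chi (perm_mx (tperm i j)).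
Proof.
move=> hij; have hP s := perm_mx_RS R s.
have hS k l : RS (redirect k l) by apply: redirect_RS.
have [s' hs'] := chi_perm (tperm i j).
apply: Rn_ge_eq => [|l].
  apply: eta_separating => [|s].
    rewrite mulmxBl !mulmxDl mul1mx !RS_evec ?subrr //; exact: chiRS.
  rewrite mulmxBl !mulmxDl mul1mx raddfB !raddfD /= !tr_chi_eta // mxtrace_eta //.
  rewrite -!raddfD -raddfB /= -mulmxDl redirect_pair // mulmxDl mul1mx subrr.
  exact: mxtrace0.
have [k hk hk'] := third l (s'^-1%g l); exists k.
have -> : (1%:M + chi (perm_mx (tperm i j))) k l = 0.
  rewrite hs' perm_mx_fun !mxE (negPf hk) add0r.
  by have [h|//] := eqVneq (s' k) l; rewrite -h permK eqxx in hk'.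
by rewrite mxE; apply: addr_ge0; apply (chiRS (hS _ _)).1.
Qed.

(** Transpositions are the permutations of trace [n - 2]. *)
Lemma chi_tperm i j : i != j -> exists p q,
  p != q /\ chi (perm_mx (tperm i j)) = perm_mx (tperm p q).
Proof.
move=> hij; have [s hs] := chi_perm (tperm i j).
have moved_t : [set k | tperm i j k != k] = [set i; j].
  apply/setP=> k; rewrite !inE; case: tpermP => [->|->|/eqP hi /eqP hj].
  - by rewrite eqxx eq_sym hij.
  - by rewrite eqxx orbT hij.
  - by rewrite eqxx (negPf hi) (negPf hj).
have : \tr (perm_mx s : 'M[R]_n) = \tr (perm_mx (tperm i j) : 'M[R]_n).
  by rewrite -hs mxtrace_chi //; apply: perm_mx_RS.
rewrite !mxtrace_perm_mx moved_t cards2 hij => /addrI/oppr_inj/eqP.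
rewrite eqr_nat => /cards2P[p [q [hpq hm]]].
have mv k : (s k != k) = (k \in [set p; q]) by rewrite -hm inE.
have sp : s p = q.
  have hp : s p != p by rewrite mv !inE eqxx.
  have : s (s p) != s p by rewrite (inj_eq perm_inj).
  by rewrite mv !inE (negPf hp) => /eqP.
have sq : s q = p.
  have hq : s q != q by rewrite mv !inE eqxx orbT.
  have : s (s q) != s q by rewrite (inj_eq perm_inj).
  by rewrite mv !inE (negPf hq) orbF => /eqP.
exists p, q; split=> //; rewrite hs; congr perm_mx; apply/permP=> k.
case: tpermP => [->//|->//|/eqP hkp /eqP hkq].
by apply/eqP/negbNE; rewrite mv !inE negb_or hkp.
Qed.

(** The off-diagonal entries of [chi (redirect i j)] are nonnegative and bounded
by those of the transposition [(p q)], and they add up to 1 because the trace is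
[n - 1]. *)
Lemma chi_redirect_edge i j : i != j -> exists p q,
  [/\ p != q, chi (perm_mx (tperm i j)) = perm_mx (tperm p q),
      forall k l, k != l ->
        chi (redirect i j) k l + chi (redirect j i) k l = (tperm p q k == l)%:R
    & chi (redirect i j) p q + chi (redirect i j) q p = 1].
Proof.
move=> hij; have [p [q [hpq ht]]] := chi_tperm hij; exists p, q.
have hS k l : RS (chi (redirect k l)) by apply/chiRS/redirect_RS.
have off k l : k != l ->
    chi (redirect i j) k l + chi (redirect j i) k l = (tperm p q k == l)%:R.
  move=> hkl; have /matrixP/(_ k l) := chi_redirect_pair hij.
  by rewrite ht perm_mx_fun !mxE (negPf hkl) add0r.
split=> //.
have z k l : k != l -> tperm p q k != l -> chi (redirect i j) k l = 0.
  move=> hkl htk; have := off k l hkl; rewrite (negPf htk) mulr0n.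
  have := (hS i j).1 k l; have := (hS j i).1 k l; lra.
have := RS_trE (hS i j).
rewrite mxtrace_chi ?mxtrace_redirect1 //; last exact: redirect_RS.
rewrite opprB addrC subrK => <-.
have hqp : q != p by rewrite eq_sym.
have row k l : k != l -> tperm p q k = l ->
    \sum_(m | m != k) chi (redirect i j) k m = chi (redirect i j) k l.
  move=> hkl hk; have hlk : l != k by rewrite eq_sym.
  rewrite (bigD1 l) //= big1 ?addr0 // => m /andP[m1 m2].
  by apply: z; rewrite ?hk eq_sym.
rewrite (bigD1 p) //= (row p q) ?tpermL // (bigD1 q) //= (row q p) ?tpermR //.
rewrite big1 ?addr0 // => k /andP[k1 k2]; apply: big1 => m hm.
by apply: z; rewrite ?tpermD // eq_sym.
Qed.

(** Transport of [sum_i redirect i j = (n - 1) 1 + e e_j^T].  Both [e e_j^T] and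
the uniform matrix [e e^T / n] have trace 1 against every row stochastic matrix,
so the latter can stand for the image of the former. *)
Lemma chi_redirect_col_sum j : exists u : 'I_n -> R, [/\ forall l, 0 <= u l,
    \sum_l u l = 1
  & forall k l, k != l -> \sum_i chi (redirect i j) k l = u l].
Proof.
have n0 : n%:R != 0 :> R by rewrite pnatr_eq0; lia.
have hS i : RS (redirect i j) by apply: redirect_RS.
have eTe : e^T *m e = n%:R%:M.
  apply/matrixP=> i i'; rewrite !ord1 !mxE /=.
  by under eq_bigr do rewrite !mxE mulr1; rewrite sumr_const card_ord.
have : Rn (\sum_i chi (redirect i j) - (n%:R - 1) *: 1%:M - n%:R^-1 *: (e *m e^T)).
  apply: eta_separating => [|s].
    rewrite !mulmxBl mulmx_suml -!scalemxAl mul1mx -mulmxA eTe mul_mx_scalar.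
    rewrite (eq_bigr (fun=> e)) => [|i _]; last by rewrite RS_evec //; exact/chiRS.
    rewrite scalerA mulVf // sumr_const card_ord -scaler_nat.
    by apply/matrixP=> k l; rewrite !mxE; ring.
  have trJ : \tr (e *m e^T *m eta (perm_mx s)) = n%:R.
    rewrite -mulmxA mxtrace_mulC -mulmxA RS_evec ?eTe ?mxtrace_scalar //.
    exact/etaRS/perm_mx_RS.
  rewrite !mulmxBl mulmx_suml -!scalemxAl mul1mx !raddfB raddf_sum /= !mxtraceZ.
  rewrite mxtrace_eta ?trJ ?mulVf //; last exact: perm_mx_RS.
  rewrite (eq_bigr (fun i => \tr (perm_mx s) - perm_mx s i i
                               + perm_mx s j i)) => [|i _].
    2: by rewrite tr_chi_eta ?mxtrace_redirect //; apply: perm_mx_RS.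
  rewrite big_split /= sumrB sumr_const card_ord -/(mxtrace _).
  by rewrite (perm_mx_RS R s).2 -mulr_natl; ring.
case/RnP=> v hv h; exists (fun l => v l + n%:R^-1).
have hu k l : k != l -> \sum_i chi (redirect i j) k l = v l + n%:R^-1.
  move=> hkl; rewrite -(h k l) !mxE summxE (negPf hkl) big_ord1 !mxE.
  by rewrite !mulr1 mulr0 subr0 subrK.
split=> // [l|].
  have [k hk _] := third l l; rewrite -(hu _ _ hk).
  by apply: sumr_ge0 => i _; apply (chiRS (hS i)).1.
by rewrite big_split /= hv add0r sumr_const card_ord -[LHS]mulr_natr mulVf.
Qed.

(** The edge [{k, l}] carries total weight 1 or 0 in [chi (redirect i j)], and
weight 1 identifies the image of the transposition [(i j)]. *)
Lemma chi_redirect_edge_weight i j k l : i != j -> k != l ->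
  (chi (perm_mx (tperm i j)) = perm_mx (tperm k l) /\
    chi (redirect i j) k l + chi (redirect i j) l k = 1) \/
  chi (redirect i j) k l + chi (redirect i j) l k = 0.
Proof.
move=> hij hkl; have [p [q [hpq ht off hw]]] := chi_redirect_edge hij.
have [h|h] := eqVneq (tperm p q k) l.
  left; rewrite ht (tperm_edge hkl h); split=> //; rewrite -hw.
  move: h; case: tpermP => [->->//|->->|_ _ h]; first by rewrite addrC.
  by rewrite h eqxx in hkl.
have h' : tperm p q l != k by apply: contra h => /eqP <-; rewrite tpermK.
right; have := off _ _ hkl; rewrite (negPf h) mulr0n.
have := off l k; rewrite eq_sym hkl (negPf h') mulr0n => /(_ isT).
have ge0 i' j' k' l' : 0 <= chi (redirect i' j') k' l'.
  by apply (chiRS (redirect_RS R i' j')).1.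
have := ge0 i j k l; have := ge0 j i k l; have := ge0 i j l k.
have := ge0 j i l k; lra.
Qed.

(** With [u] the column weights, at most one [i] contributes to
[u k + u l] by injectivity of [chi] on transpositions, so [u k + u l = 1]
whenever [u k > 0].  A third index then forces [u k = 1], that is, all the
weight sits in one column [c]. *)
Lemma chi_redirect_target j : exists c, forall k l i, k != l -> l != c ->
  chi (redirect i j) k l = 0.
Proof.
have [u [u0 u1 hu]] := chi_redirect_col_sum j.
have hu2 k l : k != l ->
    u k + u l = \sum_i (chi (redirect i j) k l + chi (redirect i j) l k).
  by move=> hkl; rewrite big_split /= !hu ?[u k + _]addrC // eq_sym.
have term0 k l : k != l -> chi (redirect j j) k l + chi (redirect j j) l k = 0.
  move=> hkl; rewrite redirect_id chi1 !mxE (negPf hkl) eq_sym (negPf hkl).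
  by rewrite addr0.
have u01 k l : k != l -> u k != 0 -> u k + u l = 1.
  move=> hkl hk; rewrite hu2 //.
  have [i /andP[hij hi]] : exists i, (i != j) && 
      (chi (redirect i j) k l + chi (redirect i j) l k != 0).
    case: (pickP (fun i => (i != j) && 
      (chi (redirect i j) k l + chi (redirect i j) l k != 0))) => [i hi|h].
      by exists i.
    have : u k + u l = 0.
      rewrite hu2 //; apply: big1 => i _; have := h i.
      by have [->|_ /= /negbFE/eqP//] := eqVneq i j; rewrite term0.
    have := u0 k; have := u0 l => h1 h2 h3.
    by case/eqP: hk; lra.
  have [[hi1 ht]|/eqP] := chi_redirect_edge_weight hij hkl; last by rewrite (negPf hi).
  rewrite (bigD1 i) //= ht big1 ?addr0 // => i' hi'.
  have [->|hi'j] := eqVneq i' j; first by rewrite term0.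
  have [[hi1' _]|//] := chi_redirect_edge_weight hi'j hkl.
  have /permP/(_ j) := chi_perm_inj (etrans hi1' (esym hi1)).
  by rewrite !tpermR => h; rewrite h eqxx in hi'.
have [p hp] : exists p, u p != 0.
  case: (pickP (fun p => u p != 0)) => [p hp|h]; first by exists p.
  have := u1; rewrite big1 => [/eqP|p _]; last exact/eqP/negbFE/h.
  by rewrite eq_sym oner_eq0.
exists p => k l i hkl hlp.
have ul : u l = 0.
  have [r hrl hrp] := third l p.
  have := u1; rewrite (bigD1 p) //= (bigD1 l) //= (bigD1 r) /= ?hrl ?hrp //.
  have : 0 <= \sum_(m | (m != p) && (m != l) && (m != r)) u m by apply: sumr_ge0.
  have := u01 p l; rewrite eq_sym hlp => /(_ isT hp).
  have := u01 p r; rewrite eq_sym hrp => /(_ isT hp).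
  have := u0 l; have := u0 r; lra.
have := hu k l hkl; rewrite ul => /psumr_eq0P -> // i' _.
by apply (chiRS (redirect_RS R i' j)).1.
Qed.

(** Let [(p q)] be the image of [(i j)].  All the weight of [chi (redirect i j)]
lies in column [c j], so [c j] is [p] or [q], say [q], and the weight is at
[(p, q)].  The matrix [chi (redirect j i)] carries the complementary weight at
[(q, p)], whence [p = c i]. *)
Lemma chi_redirect_relabel : exists c : 'I_n -> 'I_n, injective c /\
  forall i j, chi (redirect i j) = redirect (c i) (c j).
Proof.
have [c hc] := fin_all_exists chi_redirect_target; exists c.
have key i j : i != j -> c i != c j /\ forall k l, k != l ->
    chi (redirect i j) k l = ((k == c i) && (l == c j))%:R.
  move=> hij.
  have main p q : p != q -> q = c j ->
      (forall k l, k != l ->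
        chi (redirect i j) k l + chi (redirect j i) k l = (tperm p q k == l)%:R) ->
      chi (redirect i j) p q + chi (redirect i j) q p = 1 ->
      c i != c j /\ forall k l, k != l ->
        chi (redirect i j) k l = ((k == c i) && (l == c j))%:R.
    move=> hpq hq off; have hqp : q != p by rewrite eq_sym.
    rewrite (hc j q p) -?hq // addr0 => hw.
    have := off q p hqp; rewrite (hc j q p) -?hq // add0r tpermR eqxx => hji.
    have hp : p = c i.
      apply/eqP/negP => /negP hp; move: hji; rewrite (hc i q p) // => /eqP.
      by rewrite eq_sym oner_eq0.
    rewrite -hp -?hq; split=> // k l hkl.
    have [lq|hl] := eqVneq l q; last by rewrite andbF hc // -hq.
    rewrite lq in hkl *; rewrite andbT; have [->//|hk] := eqVneq k p.
    have tk : tperm p q k = k by apply: tpermD; rewrite eq_sym.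
    have := off k q hkl; rewrite tk (negPf hkl).
    have := (chiRS (redirect_RS R i j)).1 k q.
    have := (chiRS (redirect_RS R j i)).1 k q.
    by rewrite mulr0n; lra.
  have [p [q [hpq ht off hw]]] := chi_redirect_edge hij.
  have [hq|hq] := eqVneq q (c j); first exact: (main p q).
  have [hp|hp] := eqVneq p (c j).
    apply: (main q p); rewrite ?hp // 1?eq_sym -?hp //.
      by move=> k l hkl; rewrite off // tpermC.
    by rewrite addrC.
  have hqp : q != p by rewrite eq_sym.
  by move: hw; rewrite !hc // addr0 => /eqP; rewrite eq_sym oner_eq0.
split=> [i j h|i j].
  by apply/eqP/negP=> /negP /key[]; rewrite h eqxx.
have [->|hij] := eqVneq i j; first by rewrite !redirect_id chi1.
apply: RS_off_diag_eq => [||k l hkl]; [exact/chiRS/redirect_RS|exact: redirect_RS|].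
have [_ ->//] := key i j hij; rewrite redirectE [l == _]eq_sym.
by have [_|_] := eqVneq k (c i); rewrite //= (negPf hkl).
Qed.

(** On redirections [chi] is exactly the conjugation [X |-> S X S^T].  Hence
[perm_mx t - S^T eta(perm_mx t) S] has trace zero against all redirections, so
it lies in [Rn] and has trace zero against every [A]. *)
Lemma chi_conj_large : exists s, forall A, RS A ->
  Rn (chi A - perm_mx s *m A *m (perm_mx s)^T).
Proof.
have [c [cinj hc]] := chi_redirect_relabel.
pose s := (perm cinj)^-1%g; exists s.
have hs i : s (c i) = i by rewrite -[X in s X](permE cinj) permK.
set S : 'M[R]_n := perm_mx s.
have redirectC i j : chi (redirect i j) = S *m redirect i j *m S^T.
  apply/matrixP=> k l; rewrite hc perm_conj_mxE !redirectE.
  have -> : (s k == i) = (k == c i).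
    by rewrite -[k in RHS](permKV (perm cinj)) permE (inj_eq cinj).
  congr (nat_of_bool _)%:R; rewrite -[l in LHS](permKV (perm cinj)) -/s permE.
  case: ifP => // _; first by rewrite (inj_eq cinj).
  by rewrite -[k in LHS](permKV (perm cinj)) -/s permE (inj_eq cinj).
move=> A hA; apply: eta_separating => [|t].
  by rewrite mulmxBl (RS_evec (RS_perm_conj s hA)) RS_evec ?subrr //; exact: chiRS.
have hP : RS (perm_mx t : 'M[R]_n) by apply: perm_mx_RS.
have swap B : \tr (S *m B *m S^T *m eta (perm_mx t)) =
    \tr (B *m (S^T *m eta (perm_mx t) *m S)).
  by rewrite -!mulmxA mxtrace_mulC -!mulmxA.
have hS : RS S by apply: perm_mx_RS.
have hST : RS S^T by rewrite tr_perm_mx; apply: perm_mx_RS.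
have hY : Rn (perm_mx t - S^T *m eta (perm_mx t) *m S).
  apply: redirect_separating => [|i j].
    rewrite mulmxBl !RS_evec ?subrr //.
    by apply: RS_mul => //; apply: RS_mul => //; apply: etaRS.
  have hij : RS (redirect i j) by apply: redirect_RS.
  by rewrite mulmxBr raddfB /= -swap -redirectC tr_chi_eta ?subrr.
rewrite mulmxBl raddfB /= tr_chi_eta // swap -raddfB -mulmxBr /=.
exact: Rn_tr_mull.
Qed.

End AtLeastThree.

Lemma chi_conj : exists s, forall A, RS A ->
  Rn (chi A - perm_mx s *m A *m (perm_mx s)^T).
Proof.
have [n2|n2] := leqP n 2; last exact: chi_conj_large.
exists 1%g => A hA; rewrite perm_mx1 trmx1 mulmx1 mul1mx.
exact: chi_small.
Qed.

(** The trace pairing with [chi] determines [eta] modulo [Rn]: take for [A] the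
preimages [S^T perm_mx t S] of the permutation matrices. *)
Lemma eta_conj s : (forall A, RS A -> Rn (chi A - perm_mx s *m A *m (perm_mx s)^T)) ->
  forall B, RS B -> Rn (eta B - perm_mx s *m B *m (perm_mx s)^T).
Proof.
set S : 'M[R]_n := perm_mx s => h B hB.
have hS : RS S by apply: perm_mx_RS.
have hST : RS S^T by rewrite tr_perm_mx; apply: perm_mx_RS.
apply: perm_separating => [|t].
  by rewrite mulmxBl (RS_evec (RS_perm_conj s hB)) RS_evec ?subrr //; exact: etaRS.
pose A := S^T *m perm_mx t *m S.
have hA : RS A by apply: RS_mul => //; apply: RS_mul => //; apply: perm_mx_RS.
have SA : S *m A *m S^T = perm_mx t.
  by rewrite /A !mulmxA perm_mx_tr1 mul1mx -mulmxA perm_mx_tr1 mulmx1.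
have := Rn_tr_mulr (etaRS hB) (h A hA).
rewrite -/S SA mulmxBl raddfB /= tr_chi_eta // => /eqP; rewrite subr_eq0 => /eqP trAB.
rewrite mulmxBl raddfB /= mxtrace_mulC -trAB /A.
rewrite -!mulmxA [X in X - _]mxtrace_mulC -!mulmxA.
rewrite [X in X - _]mxtrace_mulC -!mulmxA; exact: subrr.
Qed.

End TracePair.

(** * From preserved traces of products to the permutation form *)

Section Families.
Variables (R : realType) (n : nat).
Implicit Types (A B X Y N : 'M[R]_n).

Lemma prod_RS (I : Type) (r : seq I) (F : I -> 'M[R]_n) :
  (forall i, RS (F i)) -> RS (\prod_(i <- r) F i).
Proof.
move=> h; elim/big_rec: _ => [|i X _ hX]; first exact: RS1.
exact: RS_mul.
Qed.

(** By cyclicity each factor has a row stochastic inverse, namely the product of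
the factors after it times the product of those before it. *)
Lemma prod_RS_eq1_perm (I : finType) (F : I -> 'M[R]_n) (i : I) :
  (forall i, RS (F i)) -> \prod_i F i = 1 -> is_perm_mx (F i).
Proof.
move=> hF; case/path.splitPr: (mem_index_enum i) => r1 r2.
rewrite big_cat big_cons /= mulrA -mulmxE => h.
have := mulmx1C h; rewrite mulmxA => /mulmx1C; rewrite mulmxA.
move=> h'; apply: (RS_inv_perm (hF i) _ (B := _ *m _)).
  by apply: RS_mul; [exact: (prod_RS r2 hF)|exact: (prod_RS r1 hF)].
by rewrite mulmxA; have := h'.
Qed.

Lemma prod_telescope m (P : 'I_m.+1 -> 'M[R]_n) (X : 'I_m -> 'M[R]_n) :
  (forall i, is_perm_mx (P i)) ->
  \prod_(i < m) (Pcur P i *m X i *m (Pnext P i)^T) =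
  P ord0 *m (\prod_(i < m) X i) *m (P ord_max)^T.
Proof.
elim: m P X => [|m IH] P X hP.
  rewrite !big_ord0 -idmxE mulmx1 (_ : ord_max = ord0) ?is_perm_mx_mulT //.
  exact: val_inj.
rewrite !big_ord_recl -mulmxE.
have -> : \prod_(i < m) (Pcur P (lift ord0 i) *m X (lift ord0 i)
                          *m (Pnext P (lift ord0 i))^T) =
    \prod_(i < m) (Pcur (P \o lift ord0) i *m X (lift ord0 i)
                   *m (Pnext (P \o lift ord0) i)^T).
  by apply: eq_bigr => i _; congr (P _ *m _ *m _); apply: val_inj.
rewrite IH => [|i]; last exact: hP.
have -> : (P \o lift ord0) ord_max = P ord_max by congr P; apply: val_inj.
have -> : Pcur P ord0 = P ord0 by congr P; apply: val_inj.
rewrite /Pnext /= !mulmxA.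
by rewrite -[P ord0 *m X ord0 *m _ *m _]mulmxA is_perm_mx_Tmul ?mulmx1.
Qed.

Lemma prod_pair m (F : 'I_m.+1 -> 'M[R]_n) (j : 'I_m) :
  (forall i, i != ord0 -> i != lift ord0 j -> F i = 1) ->
  \prod_i F i = F ord0 *m F (lift ord0 j).
Proof.
move=> h; rewrite big_ord_recl -mulmxE; congr (_ *m _).
transitivity (\prod_(i | i == j) F (lift ord0 i)); last exact: big_pred1_eq.
rewrite [RHS]big_mkcond /=; apply: eq_bigr => i _; case: eqP => // /eqP hij.
by rewrite h.
Qed.

(** The normalized maps [chi i A = G i * phi i A * (G i.+1)^T], with [G k] the
product of the first [k] matrices [phi i 1], fix the identity and keep the traces
of products because [G 0 = G m = 1].  Pairing slot 0 with each other slot shows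
that all of them are conjugation by the same permutation modulo [Rn], which
forces [P i = (G i)^T S]. *)
Lemma trace_form m (phi : 'I_m.+2 -> 'M[R]_n -> 'M[R]_n) :
  (forall i A, RS A -> RS (phi i A)) ->
  (forall A : 'I_m.+2 -> 'M[R]_n, (forall i, RS (A i)) ->
     \tr (\prod_i phi i (A i)) = \tr (\prod_i A i)) ->
  exists P gamma, has_form phi P gamma.
Proof.
move=> phiRS htr.
pose Q i := phi i 1%:M.
have hQRS i : RS (Q i) by apply/phiRS/RS1.
have prodQ : \prod_i Q i = 1.
  apply: RS_tr_eq1; first exact: prod_RS.
  rewrite htr => [|i]; last exact: RS1.
  by rewrite big1 // -idmxE mxtrace1.
have hQ i : is_perm_mx (Q i) by apply: prod_RS_eq1_perm prodQ.
(* [Qn] extends [Q] by the identity, so that partial products are indexed by nat. *)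
pose Qn k := oapp Q 1 (insub k).
have hQn k : is_perm_mx (Qn k).
  by rewrite /Qn; case: insub => [i|] /=; [exact: hQ|exact: is_perm_mx1].
have QnE (i : 'I_m.+2) : Qn i = Q i by rewrite /Qn valK.
pose G k := \prod_(0 <= l < k) Qn l.
have hG k : is_perm_mx (G k).
  rewrite /G; elim/big_rec: _ => [|l X _ hX]; first exact: is_perm_mx1.
  by rewrite -mulmxE is_perm_mxMl.
have G0 : G 0 = 1 by rewrite /G big_geq.
have Gm : G m.+2 = 1.
  by rewrite /G big_mkord -[RHS]prodQ; apply: eq_bigr => i _; rewrite QnE.
have GS (i : 'I_m.+2) : G i.+1 = G i *m Q i.
  by rewrite /G big_nat_recr //= QnE.
pose chi (i : 'I_m.+2) A := G i *m phi i A *m (G i.+1)^T.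
have hGT k : RS (G k)^T by apply: is_perm_mx_RS; rewrite is_perm_mx_tr.
have hGRS k : RS (G k) by apply: is_perm_mx_RS.
have chiRS i A : RS A -> RS (chi i A).
  by move=> hA; apply: RS_mul => //; apply: RS_mul => //; apply: phiRS.
have chi1 i : chi i 1%:M = 1%:M.
  by rewrite /chi -/(Q i) -GS is_perm_mx_mulT.
have tr_chi (A : 'I_m.+2 -> 'M[R]_n) : (forall i, RS (A i)) ->
    \tr (\prod_i chi i (A i)) = \tr (\prod_i A i).
  move=> hA; rewrite -(htr A hA).
  have := @prod_telescope _ (fun i : 'I_m.+3 => G i) (fun i => phi i (A i)).
  rewrite /Pcur /Pnext /= G0 Gm -idmxE trmx1 mul1mx mulmx1 => <- // .
have tr_pair (j : 'I_m.+1) A B : RS A -> RS B ->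
    \tr (chi ord0 A *m chi (lift ord0 j) B) = \tr (A *m B).
  move=> hA hB.
  pose F (i : 'I_m.+2) := if i == ord0 then A else if i == lift ord0 j then B else 1%:M.
  have := tr_chi F; rewrite (prod_pair (j := j)) => [|i /negPf h0 /negPf hj]; last first.
    by rewrite /F h0 hj chi1.
  rewrite (prod_pair (j := j)) => [|i /negPf h0 /negPf hj]; last by rewrite /F h0 hj.
  rewrite /F /= eqxx; apply => i.
  by case: ifP => // _; case: ifP => // _; apply: RS1.
have [s hs] := chi_conj (chiRS ord0) (chiRS (lift ord0 ord0)) (tr_pair ord0) (chi1 _).
have hsi i A : RS A -> Rn (chi i A - perm_mx s *m A *m (perm_mx s)^T).
  move=> hA; case: (unliftP ord0 i) => [j|] ->; last exact: hs.
  exact: (eta_conj (chiRS _) (tr_pair j) hs).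
set S : 'M[R]_n := perm_mx s in hs hsi.
pose P (i : 'I_m.+3) := (G i)^T *m S.
pose gamma i A := phi i A - Pcur P i *m partDS A *m (Pnext P i)^T.
exists P, gamma; split.
- by move=> i; rewrite is_perm_mxMl ?perm_mx_is_perm // is_perm_mx_tr.
- by rewrite /P /= G0 Gm.
- move=> i A hA; rewrite /gamma /Pcur /Pnext /P /= trmx_mul trmxK.
  have -> : phi i A = (G i)^T *m chi i A *m G i.+1.
    rewrite /chi !mulmxA is_perm_mx_Tmul // mul1mx -mulmxA is_perm_mx_Tmul //.
    by rewrite mulmx1.
  have hS : RS S by apply: perm_mx_RS.
  have hST : RS S^T by rewrite tr_perm_mx; apply: perm_mx_RS.
  have hR : Rn (partR A).
    have [n0|n0] := posnP n; last exact: partR_Rn.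
    apply/RnP; exists (fun=> 0) => [|k]; first by rewrite big1.
    by have := ltn_ord k; rewrite {2}n0.
  have -> : (G i)^T *m chi i A *m G i.+1 -
      (G i)^T *m S *m partDS A *m (S^T *m G i.+1) =
      (G i)^T *m ((chi i A - S *m A *m S^T) + S *m (partR A *m S^T)) *m G i.+1.
    rewrite /partDS !(mulmxDr, mulmxDl, mulmxN, mulNmx) !mulmxA opprD opprK.
    by rewrite -addrA; congr (_ + _).
  apply: (RS_Rn_mulr (hGRS _)); rewrite RS_Rn_mull //; first last.
    apply: RnD; first exact: hsi.
    by rewrite RS_Rn_mull //; apply: RS_Rn_mulr.
  apply: RnD; first exact: hsi.
  by rewrite RS_Rn_mull //; apply: RS_Rn_mulr.
- by move=> i A hA; rewrite /gamma addrC subrK.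
- by move=> i A hA; rewrite /gamma addrC subrK; apply: phiRS.
Qed.

End Families.

(** * Characteristic polynomials *)

Section Spectra.
Variables (R : realType) (n : nat).
Implicit Types (A B P N : 'M[R]_n).

(** Over the complex numbers a monic polynomial is the product over the multiset
of its roots; the embedding of the reals is injective on polynomials. *)
Lemma spec_char_poly A B : spec A = spec B <-> char_poly A = char_poly B.
Proof.
split=> h; last first.
  have /(congr1 (map_poly (real_complex R))) := h; rewrite !map_char_poly => e.
  exact: (congr1 (fun p => seq_mset (sval (closed_field_poly_normal p))) e).
apply: (@map_poly_inj _ _ (real_complex R)); rewrite !map_char_poly.
move: h; rewrite /spec; case: closed_field_poly_normal => r /= hr.
case: closed_field_poly_normal => r' /= hr' /eq_seq_msetP hrr'.
rewrite hr hr' !(monicP (char_poly_monic _)).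
by congr (_ *: _); apply: perm_big.
Qed.

Lemma char_poly_perm_conj P A : is_perm_mx P ->
  char_poly (P *m A *m P^T) = char_poly A.
Proof.
move=> hP; pose P' := map_mx (@polyC R) P.
have hPP : P' *m P'^T = 1%:M.
  by rewrite /P' map_trmx -map_mxM is_perm_mx_mulT // map_mx1.
rewrite /char_poly.
have -> : char_poly_mx (P *m A *m P^T) = P' *m char_poly_mx A *m P'^T.
  rewrite /char_poly_mx mulmxBr mulmxBl scalar_mxC -[_ *m P' *m _]mulmxA hPP.
  by rewrite mulmx1 !map_mxM map_trmx.
by rewrite !det_mulmx mulrAC -det_mulmx hPP det1 mul1r.
Qed.

(** Write [N = u w] with [w u = 0], and let [M] be the characteristic matrix of
[A], so that [M u = x u] with [x = 'X - c].  The block matrix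
[[M, u], [w, 1]] has determinant [\det (M - u w)] by clearing [w]; clearing [u]
by means of [M u = x u] instead evaluates it through [\det M]. *)
Lemma char_poly_Rn A N c : A *m evec R n = c *: evec R n -> Rn N ->
  char_poly (A + N) = char_poly A.
Proof.
move=> hA [v hv ->].
pose M := char_poly_mx A; pose u := map_mx (@polyC R) (evec R n).
pose w := map_mx (@polyC R) v^T; pose x : {poly R} := 'X - c%:P.
have Mu : M *m u = x *: u.
  rewrite /M /char_poly_mx mulmxBl mul_scalar_mx -map_mxM hA map_mxZ.
  by rewrite scalerBl.
have wu : w *m u = 0 by rewrite /w -map_mxM hv map_mx0.
have EM : char_poly_mx (A + evec R n *m v^T) = M - u *m w.
  by rewrite /char_poly_mx map_mxD map_mxM opprD addrA.
pose K : 'M_(n + 1) := block_mx M u w 1%:M.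
have e1 : K = block_mx (M - u *m w) u 0 1%:M *m block_mx 1%:M 0 w 1%:M.
  by rewrite mulmx_block ?mulmx1 ?mulmx0 ?mul1mx ?mul0mx ?add0r ?subrK ?add0r.
have e2 : K *m block_mx x%:M (- u) 0 x%:M = block_mx (x *: M) 0 (x *: w) x%:M.
  rewrite mulmx_block !mulmx0 !addr0 !mul_mx_scalar !mulmxN Mu wu addNr.
  by rewrite oppr0 add0r scalemx1.
have x0 : x != 0 by rewrite polyXsubC_eq0.
have := congr1 determinant e2; rewrite e1 !det_mulmx !det_lblock !det_ublock.
rewrite !det1 !mulr1 detZ !det_scalar expr1 -EM mulrA => /(mulIf x0).
by rewrite [RHS]mulrC => /(mulIf (expf_neq0 _ x0)).
Qed.

End Spectra.

(** * The permutation form *)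

Section Forms.
Variables (R : realType) (n : nat).
Hypothesis n_gt0 : (0 < n)%N.
Implicit Types (A B X Y N : 'M[R]_n).

Lemma form_cong m (phi gamma : 'I_m -> 'M[R]_n -> 'M[R]_n) P i A :
  has_form phi P gamma -> RS A ->
  Rn (phi i A - Pcur P i *m A *m (Pnext P i)^T).
Proof.
case=> hP _ hg hphi _ hA; rewrite hphi // /partDS !(mulmxDr, mulmxDl, mulmxN, mulNmx).
rewrite addrAC [X in X + _]addrAC subrr add0r.
have hPT j : RS (P j)^T by apply: is_perm_mx_RS; rewrite is_perm_mx_tr.
apply: RnD; last exact: hg.
apply/RnN/RS_Rn_mulr; first exact: hPT.
rewrite RS_Rn_mull; try exact: partR_Rn.
exact/is_perm_mx_RS/hP.
Qed.

(** Congruence modulo [Rn] is compatible with products of row stochastic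
matrices, so the product of the [phi i (A i)] is congruent to the telescoping
product of the [P_i A_i P_(i+1)^T]. *)
Lemma form_spec m (phi gamma : 'I_m -> 'M[R]_n -> 'M[R]_n) P :
  (forall i A, RS A -> RS (phi i A)) -> has_form phi P gamma ->
  forall A : 'I_m -> 'M[R]_n, (forall i, RS (A i)) ->
    spec (\prod_i phi i (A i)) = spec (\prod_i A i).
Proof.
move=> phiRS hform A hA; have [hP hPmax _ _ _] := hform.
have hPT j : RS (P j)^T by apply: is_perm_mx_RS; rewrite is_perm_mx_tr.
pose Y i := Pcur P i *m A i *m (Pnext P i)^T.
have hY i : RS (Y i).
  apply: RS_mul; last exact: hPT.
  by apply: RS_mul => //; apply/is_perm_mx_RS/hP.
have prodY : \prod_i Y i = P ord0 *m (\prod_i A i) *m (P ord0)^T.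
  by rewrite prod_telescope // hPmax.
have hXY : Rn (\prod_i phi i (A i) - \prod_i Y i).
  have : RS (\prod_i phi i (A i)) /\ RS (\prod_i Y i) /\
      Rn (\prod_i phi i (A i) - \prod_i Y i); last by case=> _ [].
  elim/big_rec2: _ => [|i V U _ [hU [hV hUV]]].
    by rewrite subrr; split; [exact: RS1|split; [exact: RS1|exact: Rn0]].
  rewrite -mulmxE; split; [|split]; try by apply: RS_mul => //; apply: phiRS.
  have -> : phi i (A i) *m U - Y i *m V = (phi i (A i) - Y i) *m U + Y i *m (U - V).
    by rewrite mulmxBl mulmxBr addrA subrK.
  apply: RnD; first by apply: RS_Rn_mulr => //; apply: (form_cong _ hform).
  by rewrite RS_Rn_mull.
apply/spec_char_poly.
rewrite -[\prod_i phi i (A i)](subrK (\prod_i Y i)) addrC (char_poly_Rn (c := 1)) //.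
  by rewrite prodY char_poly_perm_conj.
by rewrite scale1r RS_evec //; apply: prod_RS.
Qed.

End Forms.

(** * Linear maps of permutation form *)

Section Determined.
Variables (R : realType) (n : nat).
Hypothesis n_gt0 : (0 < n)%N.
Implicit Types (A B X Y N : 'M[R]_n).

Lemma RS_redirect_comb A : RS A ->
  A = \sum_p A p.1 p.2 *: redirect R p.1 p.2 + (1 - n%:R) *: 1%:M.
Proof.
move=> [_ hA]; rewrite -(pair_bigA _ (fun i j => A i j *: redirect R i j)) /=.
apply/matrixP=> k l; rewrite !mxE summxE (bigD1 k) //= !summxE.
rewrite (bigD1 l) //= mxE redirectE eqxx eqxx mulr1 big1 ?addr0; last first.
  by move=> j hj; rewrite mxE redirectE eqxx (negPf hj) mulr0.
rewrite (eq_bigr (fun=> (k == l)%:R)).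
  have nE : n%:R = n.-1%:R + 1 :> R by rewrite natr1 prednK.
  by rewrite sumr_const cardC1 card_ord -[_ *+ n.-1]mulr_natr nE; ring.
move=> i hi; rewrite summxE -[RHS]mul1r -[X in X * _](hA i) mulr_suml.
apply: eq_bigr => j _; rewrite mxE redirectE [k == i]eq_sym.
by rewrite (negPf hi).
Qed.

Lemma RS_lspan A : RS A -> lspan (@RS R n) A.
Proof. by case=> _ h; apply/lspan_RSP => //; exists 1. Qed.

(** By [RS_redirect_comb] redirections, which include the identity, span all row
stochastic matrices. *)
Lemma redirect_determined (f g : 'M[R]_n -> 'M[R]_n) :
  linear_between (@RS R n) (@RS R n) f ->
  (forall a X Y, g (a *: X + Y) = a *: g X + g Y) ->
  (forall i j, f (redirect R i j) = g (redirect R i j)) ->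
  forall A, RS A -> f A = g A.
Proof.
case=> F [_ hF Ff] hg hfg A hA; pose H X := F X - g X.
have spanD a X Y : lspan (@RS R n) X -> lspan (@RS R n) Y ->
    lspan (@RS R n) (a *: X + Y).
  move=> /(lspan_RSP _ n_gt0)[c hc] /(lspan_RSP _ n_gt0)[d hd].
  apply/lspan_RSP => //; exists (a * c + d) => i.
  rewrite -(hc i) -(hd i) mulr_sumr -big_split; apply: eq_bigr => j _.
  by rewrite !mxE.
have span_redirect i j : lspan (@RS R n) (redirect R i j) by apply/RS_lspan/redirect_RS.
have HD a X Y : lspan (@RS R n) X -> lspan (@RS R n) Y ->
    H (a *: X + Y) = a *: H X + H Y.
  by move=> hX hY; rewrite /H hF // hg scalerBr opprD addrACA.
have Hredirect i j : H (redirect R i j) = 0.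
  by rewrite /H Ff ?hfg ?subrr //; apply: redirect_RS.
apply/eqP; rewrite -subr_eq0 -(Ff A hA) -/(H A); apply/eqP.
rewrite (RS_redirect_comb hA).
pose i0 := Ordinal n_gt0.
have h0 : lspan (@RS R n) (0 : 'M[R]_n).
  by apply/lspan_RSP => //; exists 0 => i; apply: big1 => j _; rewrite mxE.
have H0 : H 0 = 0.
  have := HD 1 0 0 h0 h0; rewrite !scale1r addr0 => /eqP.
  by rewrite -subr_eq0 opprD addrA subrr add0r oppr_eq0 => /eqP.
pose T X := lspan (@RS R n) X /\ H X = 0.
have TD a i j X : T X -> T (a *: redirect R i j + X).
  move=> [hX HX]; split; first exact: spanD.
  by rewrite HD // Hredirect HX scaler0 addr0.
suff [] : T (\sum_p A p.1 p.2 *: redirect R p.1 p.2 + (1 - n%:R) *: 1%:M) by [].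
rewrite addrC -(redirect_id R (Ordinal n_gt0)); apply: (TD).
by elim/big_rec: _ => [|p X _]; [split|apply: TD].
Qed.

End Determined.

Section LinearMaps.
Variables (R : realType) (n : nat).
Implicit Types (A B X Y N : 'M[R]_n).

Lemma partR_linear a X Y : partR (a *: X + Y) = a *: partR X + partR Y.
Proof.
have lin (h : 'I_n -> 'I_n) (h' : 'I_n -> 'I_n) :
    \sum_k (a *: X + Y) (h k) (h' k) =
    a * (\sum_k X (h k) (h' k)) + \sum_k Y (h k) (h' k).
  by rewrite mulr_sumr -big_split; apply: eq_bigr => k _; rewrite !mxE.
apply/matrixP=> i j; rewrite [RHS]mxE [X in _ = X + _]mxE !partRE !mxE.
rewrite (lin id (fun=> j)) (eq_bigr _ (fun k _ => lin (fun=> k) id)).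
by rewrite big_split -mulr_sumr /=; ring.
Qed.

Lemma partR_DS A : (0 < n)%N -> DS A -> partR A = 0.
Proof.
move=> n_gt0 [_ hr hc]; apply/matrixP=> i j; rewrite partRE !mxE hc.
rewrite (eq_bigr (fun=> 1)) // sumr_const card_ord.
have n0 : n%:R != 0 :> R by rewrite pnatr_eq0 -lt0n.
by field.
Qed.

Lemma DS_perm s : DS (perm_mx s : 'M[R]_n).
Proof.
have [h0 h1] := perm_mx_RS R s; have [_ h2] := perm_mx_RS R s^-1%g.
split=> // j; rewrite -(h2 j); apply: eq_bigr => i _.
by rewrite -tr_perm_mx [RHS]mxE.
Qed.

Variables (P Q : 'M[R]_n) (f : 'M[R]_n -> 'M[R]_n).
Hypotheses (hP : is_perm_mx P) (hQ : is_perm_mx Q).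
Hypothesis fRS : forall A, RS A -> RS (f A).
Hypothesis f_cong : forall A, RS A -> Rn (f A - P *m A *m Q^T).
Hypothesis f_linear : linear_between (@RS R n) (@RS R n) f.

(** Undoing the permutations reduces questions about [f A] to matrices congruent
to [A]. *)
Lemma form_pullback A : RS A -> exists B,
  [/\ RS B, Rn (B - A) & f A = P *m B *m Q^T].
Proof.
move=> hA; have hPT : RS P^T by apply: is_perm_mx_RS; rewrite is_perm_mx_tr.
have hQRS := is_perm_mx_RS hQ.
exists (P^T *m f A *m Q); split.
- by apply: RS_mul => //; apply: RS_mul => //; apply: fRS.
- have -> : P^T *m f A *m Q - A = P^T *m (f A - P *m A *m Q^T) *m Q.
    rewrite mulmxBr mulmxBl; congr (_ - _); rewrite !mulmxA is_perm_mx_Tmul //.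
    by rewrite mul1mx -mulmxA is_perm_mx_Tmul // mulmx1.
  by apply: RS_Rn_mulr => //; rewrite RS_Rn_mull //; apply: f_cong.
- by rewrite !mulmxA is_perm_mx_mulT // mul1mx -mulmxA is_perm_mx_mulT // mulmx1.
Qed.

Lemma form_eq_of_zeros A : RS A -> (forall j, exists i, A i j = 0) ->
  f A = P *m A *m Q^T.
Proof.
move=> hA hz; have [B [hB hBA ->]] := form_pullback hA.
suff -> : B = A by [].
apply: (Rn_ge_eq hBA) => j; have [i hi] := hz j.
by exists i; rewrite hi; apply hB.1.
Qed.

Lemma form_linear_large : (2 < n)%N -> forall A, RS A -> f A = P *m A *m Q^T.
Proof.
move=> n3; apply: (redirect_determined (ltnW (ltnW n3)) f_linear) => [a X Y|i j].
  by rewrite mulmxDr mulmxDl -scalemxAr -scalemxAl.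
apply: form_eq_of_zeros; first exact: redirect_RS.
move=> l; have [k hki hkl] := third n3 i l; exists k.
by rewrite redirectE (negPf hki) (negPf hkl).
Qed.

Lemma form_perm s : (1 < n)%N -> f (perm_mx s) = P *m perm_mx s *m Q^T.
Proof.
move=> n2; apply: form_eq_of_zeros; first exact: perm_mx_RS.
move=> j; have : (0 < #|[set~ (s^-1)%g j]|)%N by rewrite cardsC1 card_ord; lia.
case/card_gt0P=> i; rewrite !inE => hi; exists i.
rewrite perm_mx_fun mxE; have [sij|//] := eqVneq (s i) j.
by rewrite -sij permK eqxx in hi.
Qed.

End LinearMaps.

(** Besides the two permutation matrices, on which [f] is [X |-> P X Q^T], there
are two redirections, and their sum is the sum of the permutation matrices.  So
[c] is determined by the image of one of them; it lies in [-1, 1] because that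
image is row stochastic. *)
Lemma form_linear_two (R : realType) (P Q : 'M[R]_2) (f : 'M[R]_2 -> 'M[R]_2) :
  is_perm_mx P -> is_perm_mx Q ->
  (forall A, RS A -> RS (f A)) ->
  (forall A, RS A -> Rn (f A - P *m A *m Q^T)) ->
  linear_between (@RS R 2) (@RS R 2) f ->
  exists2 c : R, -1 <= c <= 1 &
    forall A, RS A -> f A = P *m (partDS A + c *: partR A) *m Q^T.
Proof.
move=> hP hQ fRS f_cong f_lin.
pose i0 : 'I_2 := ord0; pose i1 : 'I_2 := ord_max; have h01 : i0 != i1 by [].
have ord2 (i : 'I_2) : i = i0 \/ i = i1.
  by case: i => [[|[|//]] hi]; [left|right]; apply: val_inj.
have sum2 (F : 'I_2 -> R) : \sum_i F i = F i0 + F i1.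
  by rewrite big_ord_recl big_ord1; congr (_ + F _); apply: val_inj.
have hS i j : RS (redirect R i j : 'M_2) by apply: redirect_RS.
have [B [hB hBS fB]] := form_pullback hP hQ fRS f_cong (hS i0 i1).
have /RnP[v hv hBv] := hBS; rewrite sum2 in hv.
(* [B] has equal rows [(b, 1 - b)]; its [Rn] part is [c] times the [Rn] part
   [(-1/2, 1/2)] of the redirection exactly when [c = 1 - 2 b]. *)
pose c := 1 - 2 * B i0 i0.
have hc : -1 <= c <= 1.
  have := hB.1 i0 i0; have := RS_le1 i0 i0 hB; rewrite /c; lra.
exists c => //; pose g X := P *m (partDS X + c *: partR X) *m Q^T.
have glin a X Y : g (a *: X + Y) = a *: g X + g Y.
  rewrite /g /partDS partR_linear [a *: (P *m _ *m _)]scalemxAl -mulmxDl.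
  rewrite [a *: (P *m _)]scalemxAr -mulmxDr.
  congr (_ *m _ *m _); apply/matrixP=> i j; rewrite !mxE; ring.
have gDS X : DS X -> g X = P *m X *m Q^T.
  by move=> hX; rewrite /g /partDS partR_DS // subr0 scaler0 addr0.
have g01 : f (redirect R i0 i1) = g (redirect R i0 i1).
  rewrite fB /g; congr (_ *m _ *m _); apply/matrixP=> i j.
  have Bv k l : B k l = v l + redirect R i0 i1 k l by rewrite -(hBv k l) !mxE subrK.
  have v1 : v i1 = - v i0 by apply/eqP; rewrite -addr_eq0 addrC hv.
  rewrite /partDS !mxE !big_ord1 !mxE !sum2 !mxE /=.
  have [->|->] := ord2 i; have [->|->] := ord2 j;
    rewrite /= /c !Bv !redirectE /= ?v1; by field.
have f1 : f 1%:M = g 1%:M.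
  by rewrite -perm_mx1 (form_perm hP hQ fRS f_cong) // gDS //; apply: DS_perm.
suff: forall A, RS A -> f A = g A by [].
apply: (redirect_determined (isT : (0 < 2)%N) f_lin glin) => i j.
have [->|hij] := eqVneq i j; first by rewrite redirect_id.
have g10 : f (redirect R i1 i0) = g (redirect R i1 i0).
  have [F [_ hF Ff]] := f_lin.
  have sp A : RS A -> lspan (@RS R 2) A by apply: RS_lspan.
  have eqS := redirect_pair R h01.
  have e1 : F (redirect R i0 i1 + redirect R i1 i0) =
      f (redirect R i0 i1) + f (redirect R i1 i0).
    by rewrite -[redirect R i0 i1 in LHS]scale1r hF ?scale1r ?Ff //; apply: sp.
  have e2 : F (1%:M + perm_mx (tperm i0 i1)) = f 1%:M + f (perm_mx (tperm i0 i1)).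
    rewrite -[1%:M in LHS]scale1r hF ?scale1r ?Ff //.
    - exact: perm_mx_RS.
    - exact: RS1.
    - exact/sp/RS1.
    - exact/sp/perm_mx_RS.
  have e3 : g (redirect R i0 i1 + redirect R i1 i0) =
      g (redirect R i0 i1) + g (redirect R i1 i0).
    by rewrite -[redirect R i0 i1 in LHS]scale1r glin scale1r.
  have e4 : g (1%:M + perm_mx (tperm i0 i1)) = g 1%:M + g (perm_mx (tperm i0 i1)).
    by rewrite -[1%:M in LHS]scale1r glin scale1r.
  have ft : f (perm_mx (tperm i0 i1)) = g (perm_mx (tperm i0 i1)).
    by rewrite (form_perm hP hQ fRS f_cong) // gDS //; apply: DS_perm.
  apply: (addrI (f (redirect R i0 i1))).
  by rewrite -e1 eqS e2 f1 ft -e4 -eqS e3 g01.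
have [hi|hi] := ord2 i; have [hj|hj] := ord2 j; rewrite hi hj.
- by rewrite hi hj eqxx in hij.
- exact: g01.
- exact: g10.
- by rewrite hi hj eqxx in hij.
Qed.

Theorem theorem4p6 (R : realType) (n m : nat) (hn : (0 < n)%N) (hm : (2 <= m)%N)
    (phi : 'I_m -> 'M[R]_n -> 'M[R]_n)
    (hphi : forall (i : 'I_m) (A : 'M[R]_n), RS A -> RS (phi i A)) :
  let cond1 :=
    forall A : 'I_m -> 'M[R]_n, (forall i, RS (A i)) ->
      \tr (\prod_(i < m) phi i (A i)) = \tr (\prod_(i < m) A i) in
  let cond2 :=
    forall A : 'I_m -> 'M[R]_n, (forall i, RS (A i)) ->
      spec (\prod_(i < m) phi i (A i)) = spec (\prod_(i < m) A i) in
  let cond3 :=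
    exists (P : 'I_m.+1 -> 'M[R]_n) (gamma : 'I_m -> 'M[R]_n -> 'M[R]_n),
      has_form phi P gamma in
  [/\ cond1 <-> cond2, cond2 <-> cond3
    & forall (P : 'I_m.+1 -> 'M[R]_n) (gamma : 'I_m -> 'M[R]_n -> 'M[R]_n),
        has_form phi P gamma ->
        forall l : 'I_m, linear_between (@RS R n) (@RS R n) (phi l) ->
          (n = 2%N ->
             exists2 c : R, -1 <= c <= 1 &
               forall A : 'M[R]_n, RS A ->
                 phi l A = Pcur P l *m (partDS A + c *: partR A) *m (Pnext P l)^T
                 /\ phi l A = Pcur P l *m partDS A *m (Pnext P l)^T
                              + c *: (partR A *m (Pnext P l)^T))
          /\ ((3 <= n)%N ->
             forall A : 'M[R]_n, RS A -> phi l A = Pcur P l *m A *m (Pnext P l)^T)].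
Proof.
move=> cond1 cond2 cond3.
have c13 : cond1 -> cond3.
  rewrite {}/cond1 {}/cond3 {cond2}.
  by case: m hm phi hphi => [|[|m]] // _ phi hphi; apply: trace_form.
have c32 : cond3 -> cond2 by case=> P [gamma /(form_spec hn hphi)].
have c21 : cond2 -> cond1.
  move=> h A /h/spec_char_poly hA; apply: oppr_inj.
  by rewrite -!char_poly_trace // hA.
split; [by split; auto|by split; auto|].
move=> P gamma hform l hlin; have [hP _ _ _ _] := hform.
have hcong A : RS A -> Rn (phi l A - Pcur P l *m A *m (Pnext P l)^T).
  exact: (form_cong hn l hform).
have hPl : is_perm_mx (Pcur P l) by apply: hP.
have hQl : is_perm_mx (Pnext P l) by apply: hP.
split=> [n2|n3]; last exact: form_linear_large hPl hQl (hphi l) hcong hlin n3.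
have hR A : Pcur P l *m partR A = partR A.
  by apply: RS_Rn_mull; [apply: is_perm_mx_RS|apply: partR_Rn].
have [c hc h] : exists2 c : R, -1 <= c <= 1 & forall A : 'M[R]_n, RS A ->
    phi l A = Pcur P l *m (partDS A + c *: partR A) *m (Pnext P l)^T.
  move: (Pcur P l) (Pnext P l) (phi l) (hphi l) hPl hQl hcong hlin.
  by rewrite n2 => P1 P2 f hf hP1 hP2; apply: form_linear_two.
exists c => // A hA; split; first exact: h.
by rewrite h // mulmxDr mulmxDl -scalemxAr hR scalemxAl.
Qed.
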